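(* Let $p>n\ge 1$ be integers and let $y=X\beta+\varepsilon$, where $X\in\mathbb{R}^{n\times p}$ is a random matrix, $\varepsilon\in\mathbb{R}^n$ is a random vector independent of $X$ with $\mathbb{E}[\varepsilon]=0$, and $\Omega:=\mathbb{E}[\varepsilon\varepsilon^\top]$ is finite and positive definite. Assume that $X$ is left-spherical and that $\mathrm{rank}(X)=n$ almost everywhere. Assume that $\beta\in\mathbb{R}^p$ is random, independent of $X$, with $\mathbb{E}_\beta[\beta\beta^\top]=r^2I/p$, where $r^2:=\mathbb{E}_\beta[\|\beta\|^2]<\infty$. Then the estimation risk of $\hat\beta=X^\dagger y$ satisfies $$R_E(\hat\beta)=r^2\Big(1-\frac np\Big)+\frac{\mathrm{Tr}(\Omega)}{n}\,\mathbb{E}_X\left[\int\frac1s\,dF^{XX^\top/n}(s)\right],$$ where $F^A(s):=\frac1n\sum_{i=1}^n 1\{\lambda_i(A)\le s\}$ is the empirical spectral distribution of an $n\times n$ symmetric matrix $A$ with eigenvalues $\lambda_1(A),\dots,\lambda_n(A)$.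
   Context: $A^\dagger$ denotes the Moore–Penrose inverse. The ridgeless (minimum $\ell_2$ norm) least squares estimator is $\hat\beta:=\arg\min_{b\in\mathbb{R}^p}\{\|b\|:Xb=y\}=(X^\top X)^\dagger X^\top y=X^\dagger y$. A random matrix $Z$ with $n$ rows is left-spherical if $OZ$ and $Z$ have the same distribution for every fixed orthogonal $O\in O(n)$. For a given $\beta$, the conditional estimation risk is $$R_E(\hat\beta\mid X):=\mathbb{E}\big[\|\hat\beta-\beta\|^2\mid X\big]=\|\mathbb{E}[\hat\beta\mid X]-\beta\|^2+\mathrm{Tr}(\mathrm{Cov}(\hat\beta\mid X)),$$ with the conditional expectation and covariance taken over $\varepsilon$ for the given $\beta$ and $X$, so that the assumptions on $\varepsilon$ are understood for each given $\beta$ (i.e. $\varepsilon$ is independent of $(X,\beta)$). The estimation risk is $R_E(\hat\beta):=\mathbb{E}_X[R_E(\hat\beta\mid X)]$, and, since $\beta$ is random here, it is also averaged over $\beta$. *)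

(* Defs.v *)
From HB Require Import structures.
From mathcomp Require Import all_boot all_order all_algebra.
From mathcomp Require Import all_classical all_reals all_analysis.
From mathcomp Require Import measurable_realfun.

Set Implicit Arguments.
Unset Strict Implicit.
Unset Printing Implicit Defensive.

Import Order.TTheory GRing.Theory Num.Theory.
Import numFieldNormedType.Exports.

Local Open Scope classical_set_scope.
Local Open Scope ring_scope.

(* Matrices carry the sigma-algebra generated by the entries, i.e. the Borel
   sigma-algebra of R^(m x n). *)

Definition mx_sigma {R : realType} {m n : nat} : set (set 'M[R]_(m, n)) :=
  <<s [set A | exists i j,
         preimage_set_system setT (fun M : 'M[R]_(m, n) => M i j) measurable A]
  >>.

Definition measure_mx_display : measure_display.
Proof. exact: default_measure_display. Qed.

Section matrix_measurable.
Context {R : realType} {m n : nat}.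

Let mx_sigma0 : @mx_sigma R m n set0.
Proof. exact: sigma_algebra0. Qed.

Let mx_sigmaC (A : set 'M[R]_(m, n)) : mx_sigma A -> mx_sigma (~` A).
Proof. exact: sigma_algebraC. Qed.

Let mx_sigma_bigcup (F : (set 'M[R]_(m, n))^nat) :
  (forall i, mx_sigma (F i)) -> mx_sigma (\bigcup_i (F i)).
Proof. exact: sigma_algebra_bigcup. Qed.

HB.instance Definition _ := @isMeasurable.Build measure_mx_display
  'M[R]_(m, n) mx_sigma mx_sigma0 mx_sigmaC mx_sigma_bigcup.

End matrix_measurable.

Section linear_algebra.
Context {R : realType}.

(* The library's norm `|_| on matrices is the sup norm. *)
Definition l2norm {p : nat} (v : 'cV[R]_p) : R :=
  Num.sqrt (\sum_(i < p) v i 0 ^+ 2).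

Definition is_mp_inverse {m n : nat} (A : 'M[R]_(m, n)) (B : 'M[R]_(n, m)) :=
  [/\ A *m B *m A = A,
      B *m A *m B = B,
      (A *m B)^T = A *m B &
      (B *m A)^T = B *m A].

Definition mp_inverse {m n : nat} (A : 'M[R]_(m, n)) : 'M[R]_(n, m) :=
  xget 0 [set B | is_mp_inverse A B].

Definition orthogonal_mx {n : nat} (O : 'M[R]_n) := O^T *m O = 1%:M.

Definition pos_def {n : nat} (A : 'M[R]_n) :=
  A^T = A /\ forall v : 'cV[R]_n, v != 0 -> 0 < (v^T *m A *m v) 0 0.

(* The eigenvalues of A repeated according to multiplicity, in some order;
   such a row exists for every symmetric A. *)
Definition eigenvalues {n : nat} (A : 'M[R]_n) : 'rV[R]_n :=
  xget 0 [set l : 'rV[R]_n | char_poly A = \prod_(i < n) ('X - (l 0 i)%:P)].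

Definition esd {n : nat} (A : 'M[R]_n) (s : R) : R :=
  n%:R^-1 * \sum_(i < n) (eigenvalues A 0 i <= s)%R%:R.

Lemma esd_nondecreasing {n : nat} (A : 'M[R]_n) :
  {homo esd A : x y / x <= y}.
Proof.
move=> x y xy; rewrite /esd ler_wpM2l ?invr_ge0//.
apply: ler_sum => i _; rewrite ler_nat.
by case: (boolP (_ <= x)) => // /le_trans -> //.
Qed.

Lemma esd_right_continuous {n : nat} (A : 'M[R]_n) : right_continuous (esd A).
Proof.
move=> x.
have H : \forall y \near x^'+, forall i,
    (eigenvalues A 0 i <= y) = (eigenvalues A 0 i <= x).
  apply: filter_forall => j.
  case: (leP (eigenvalues A 0 j) x) => [lx|xl]; near=> z.
    by rewrite (le_trans lx)//; near: z; exact: nbhs_right_ge.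
  by apply/negbTE; rewrite -ltNge; near: z; exact: nbhs_right_lt.
apply: (@cvg_near_cst R^o); apply: filterS H => y H.
by rewrite /esd; congr *%R; apply: eq_bigr => i _; rewrite H.
Unshelve. all: by end_near. Qed.

HB.instance Definition _ (n : nat) (A : 'M[R]_n) :=
  isCumulative.Build R _ R (esd A)
    (@esd_nondecreasing n A) (@esd_right_continuous n A).

End linear_algebra.

Section probability.
Context {R : realType} {d : measure_display} {T : measurableType d}.
Variable P : probability T R.

Definition mx_integrable {m n : nat} (M : T -> 'M[R]_(m, n)) :=
  forall i j, P.-integrable setT (fun w => (M w i j)%:E).

Definition mx_expectation {m n : nat} (M : T -> 'M[R]_(m, n)) : 'M[R]_(m, n) :=
  \matrix_(i, j) fine ('E_P[fun w => M w i j])%E.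

Definition independent {d1 d2 : measure_display}
    {T1 : measurableType d1} {T2 : measurableType d2}
    (U : T -> T1) (V : T -> T2) :=
  forall A B, measurable A -> measurable B ->
    P (U @^-1` A `&` V @^-1` B) = (P (U @^-1` A) * P (V @^-1` B))%E.

Definition left_spherical {n p : nat} (Z : T -> 'M[R]_(n, p)) :=
  forall O : 'M[R]_n, orthogonal_mx O ->
  forall A : set 'M[R]_(n, p), measurable A ->
    pushforward P (fun w => O *m Z w) A = pushforward P Z A.

(* [g] is a version of E[f | sigma(U)], for nonnegative [f]; values in [0, +oo],
   no integrability of [f] is required. *)
Definition is_cond_expectation {d' : measure_display} {T' : measurableType d'}
    (U : T -> T') (f g : T -> \bar R) :=
  [/\ measurable_fun setT (g : g_sigma_algebra_preimageType U -> \bar R),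
      forall w, (0 <= g w)%E &
      forall A, g_sigma_algebra_preimage U A ->
        (\int[P]_(w in A) g w = \int[P]_(w in A) f w)%E].

Definition cond_expectation {d' : measure_display} {T' : measurableType d'}
    (U : T -> T') (f : T -> \bar R) : T -> \bar R :=
  xget (cst 0%E) [set g | is_cond_expectation U f g].

End probability.

Section ridgeless.
Context {R : realType} {d : measure_display} {T : measurableType d}.
Variables (P : probability T R) (n p : nat).

Definition ridgeless (X : 'M[R]_(n, p)) (y : 'cV[R]_n) : 'cV[R]_p :=
  mp_inverse X *m y.

Variables (X : T -> 'M[R]_(n, p)) (beta : T -> 'cV[R]_p) (eps : T -> 'cV[R]_n).

(* [beta] being random, "given X, for the given beta" is conditioning on the
   pair (X, beta): only the noise is averaged out. *)
Definition cond_estimation_risk : T -> \bar R :=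
  cond_expectation P (fun w => (X w, beta w))
    (fun w => let y := X w *m beta w + eps w in
              (l2norm (ridgeless (X w) y - beta w) ^+ 2)%:E).

Definition estimation_risk : \bar R := (\int[P]_w cond_estimation_risk w)%E.

End ridgeless.

(* Main.v *)
Require Import Defs.
From HB Require Import structures.
From mathcomp Require Import all_boot all_order all_algebra.
From mathcomp Require Import all_classical all_reals all_analysis.
From mathcomp Require Import measurable_realfun.
From mathcomp Require Import ring lra.
From mathcomp Require Import complex.

Set Implicit Arguments.
Unset Strict Implicit.
Unset Printing Implicit Defensive.

Import Order.TTheory GRing.Theory Num.Theory.
Import numFieldNormedType.Exports.

Local Open Scope classical_set_scope.
Local Open Scope ring_scope.

(* With K = X^T (X X^T)^-1 the error is (K X - 1) beta + K eps, and integrating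
   out eps, which is independent of (X, beta), leaves
   |(K X - 1) beta|^2 + Tr (K Omega K^T).  As K X is a projection of rank n and
   E[beta beta^T] = r^2 I / p, the first term has mean r^2 (1 - n / p) by Tonelli.
   For the second term, Tr (K Omega K^T) = Tr (Omega S) with S = (X X^T)^-1, and
   left-sphericity lets us replace S by O S O^T for every orthogonal O.  The
   average of O S O^T over the signed cyclic shifts O is already (Tr S / n) I, and
   since all integrands are nonnegative this needs no integrability of S.
   Finally Tr S is the integral of 1/s against the spectral distribution of
   X X^T / n, by the spectral theorem over the complex numbers. *)

(** * Moore-Penrose inverse of a matrix with full row rank *)

Section pseudoinverse.
Context {R : realType}.

Lemma l2norm_sqr p (v : 'cV[R]_p) : l2norm v ^+ 2 = \sum_i v i 0 ^+ 2.
Proof. by rewrite sqr_sqrtr// sumr_ge0// => i _; exact: sqr_ge0. Qed.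

Lemma sum_sqr_mxE m n (A : 'M[R]_(m, n)) :
  \sum_i \sum_j A i j ^+ 2 = \tr (A *m A^T).
Proof.
apply: eq_bigr => i _; rewrite mxE.
by apply: eq_bigr => j _; rewrite mxE expr2.
Qed.

(** If [v A A^T = 0] then the squared length of [v A] is zero, and full row rank turns [v A = 0]
    into [v = 0]. Conversely the rank of a product is at most that of its left factor. *)
Lemma gram_unitmx m n (A : 'M[R]_(m, n)) :
  (A *m A^T \in unitmx) = (\rank A == m).
Proof.
apply/idP/eqP => [AAT|rA].
  apply/eqP; rewrite eqn_leq rank_leq_row/=.
  by rewrite -{1}(mxrank_unit AAT) mxrankM_maxl.
rewrite -row_free_unit -kermx_eq0; apply/rowV0P => v /sub_kermxP vAA.
have : \sum_i \sum_j (v *m A) i j ^+ 2 = 0.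
  by rewrite sum_sqr_mxE trmx_mul -mulmxA (mulmxA A) mulmxA vAA mul0mx mxtrace0.
rewrite big_ord1 => /eqP.
rewrite psumr_eq0 => [/allP vA0|j _]; last exact: sqr_ge0.
have fA : row_free A by rewrite /row_free rA.
apply: (row_free_inj fA); rewrite mul0mx; apply/rowP => j; rewrite [RHS]mxE.
by have := vA0 j (mem_index_enum _); rewrite sqrf_eq0 => /eqP.
Qed.

(** The symmetry axioms allow transposing a product of two projections, which gives [A B = A C] and
    [B A = C A]. Then [B = B A B = B A C = C A C = C]. *)
Lemma mp_inverse_unique m n (A : 'M[R]_(m, n)) (B C : 'M[R]_(n, m)) :
  is_mp_inverse A B -> is_mp_inverse A C -> B = C.
Proof.
move=> [ABA BAB ABs BAs] [ACA CAC ACs CAs].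
have AB_AC : A *m B = A *m C.
  rewrite -[in LHS]ACA -[A *m C *m A *m B]mulmxA -ABs -ACs -trmx_mul.
  by rewrite mulmxA ABA.
have BA_CA : B *m A = C *m A.
  rewrite -[in LHS]ACA (mulmxA B) (mulmxA B) -(mulmxA (B *m A)) -BAs -CAs.
  by rewrite -trmx_mul -(mulmxA C) (mulmxA A) ABA.
by rewrite -BAB -mulmxA AB_AC mulmxA BA_CA CAC.
Qed.

(* The Moore-Penrose inverse of a matrix with independent rows, written as a
   rational function of the entries so that measurability is clear; it is [0]
   when [A *m A^T] is singular. *)
Definition rpinv m n (A : 'M[R]_(m, n)) : 'M[R]_(n, m) :=
  (\det (A *m A^T))^-1 *: (A^T *m \adj (A *m A^T)).

Variables (m n : nat) (A : 'M[R]_(m, n)).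
Hypothesis rA : \rank A = m.

Let AAT : A *m A^T \in unitmx. Proof. by rewrite gram_unitmx rA. Qed.

Lemma rpinvE : rpinv A = A^T *m invmx (A *m A^T).
Proof. by rewrite /invmx AAT -scalemxAr. Qed.

Lemma mul_rpinv : A *m rpinv A = 1%:M.
Proof. by rewrite rpinvE mulmxA mulmxV. Qed.

Lemma rpinv_mul_sym : (rpinv A *m A)^T = rpinv A *m A.
Proof.
by rewrite rpinvE !trmx_mul trmxK trmx_inv trmx_mul trmxK mulmxA.
Qed.

Lemma mp_inverse_rpinv : mp_inverse A = rpinv A.
Proof.
have H : is_mp_inverse A (rpinv A).
  split; [| |by rewrite mul_rpinv trmx1|exact: rpinv_mul_sym].
    by rewrite mul_rpinv mul1mx.
  by rewrite -mulmxA mul_rpinv mulmx1.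
exact: (mp_inverse_unique (xgetPex 0 (ex_intro _ _ H)) H).
Qed.

Lemma rpinvT_mul : (rpinv A)^T *m rpinv A = invmx (A *m A^T).
Proof.
rewrite rpinvE trmx_mul trmxK trmx_inv trmx_mul trmxK -mulmxA.
by rewrite (mulmxA A) mulmxV// mulmx1.
Qed.

(** [rpinv A *m A] is the orthogonal projection onto the row space. The squared Frobenius norm of
    the complementary projection is its trace, hence its rank. *)
Lemma mxtrace_rowspace_compl :
  \sum_i \sum_j (rpinv A *m A - 1%:M) i j ^+ 2 = n%:R - m%:R.
Proof.
rewrite sum_sqr_mxE linearB/= trmx1 rpinv_mul_sym mulmxBr mulmx1.
rewrite mulmxBl mul1mx -mulmxA (mulmxA A) mul_rpinv mul1mx subrr sub0r opprB.
by rewrite raddfB/= mxtrace1 mxtrace_mulC mul_rpinv mxtrace1.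
Qed.

End pseudoinverse.

(** * Sum of reciprocal eigenvalues as a trace *)

Section eigenvalues.

Lemma char_poly_diagonalizable (F : fieldType) n (P : 'M[F]_n) (D : 'rV[F]_n) :
  P \in unitmx ->
  char_poly (invmx P *m diag_mx D *m P) = \prod_i ('X - (D 0 i)%:P).
Proof.
move=> uP; rewrite /char_poly.
have -> : char_poly_mx (invmx P *m diag_mx D *m P) =
    map_mx polyC (invmx P) *m char_poly_mx (diag_mx D) *m map_mx polyC P.
  rewrite /char_poly_mx !map_mxM/= mulmxBr mulmxBl; congr (_ - _).
  rewrite scalar_mxC -mulmxA -map_mxM/= mulVmx//.
  by rewrite map_mx1 mulmx1.
rewrite !det_mulmx mulrAC -det_mulmx -map_mxM/= mulVmx// map_mx1 det1 mul1r.
rewrite -/(char_poly _) char_poly_trig ?diag_mx_is_trig//.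
by apply: eq_bigr => i _; rewrite mxE eqxx.
Qed.

(** [eigenvalues] is only known through the characteristic polynomial. The matrix is diagonalized
    unitarily over the complex numbers, and unique factorization into linear factors identifies the
    chosen row with the spectral diagonal up to a permutation, under which the sum is invariant. *)
Lemma sum_inv_eigenvalues (R : realType) n (A : 'M[R]_n) :
  A^T = A -> A \in unitmx ->
  \sum_i (eigenvalues A 0 i)^-1 = \tr (invmx A).
Proof.
move=> AT uA.
pose C := (complex R : numClosedFieldType).
pose toC : {rmorphism R -> C} := @real_complex_def R (Phant R).
pose B := map_mx toC A.
have toCr x : toC x \is Num.real.
  by apply/complex_realP; exists x.
have Bh : B \is hermsymmx.
  apply: realsym_hermsym; last by apply/mxOverP => i j; rewrite mxE.
  apply/is_hermitianmxP; rewrite expr0 scale1r; apply/matrixP => i j.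
  by rewrite !mxE/= -[in LHS]AT mxE.
have /orthomx_spectralP BE := hermitian_normalmx Bh.
have /mxOverP Dr := hermitian_spectral_diag_real Bh.
set Q := spectralmx B in BE; set D := spectral_diag B in BE Dr.
have uQ : Q \in unitmx := spectral_unit _.
have cB : char_poly B = \prod_i ('X - (D 0 i)%:P).
  by rewrite BE char_poly_diagonalizable.
(* The spectrum is real, so the polynomial already splits over [R] and [xget] does not return its
   default value. *)
have ex : exists l : 'rV[R]_n, char_poly A = \prod_(i < n) ('X - (l 0 i)%:P).
  exists (\row_i complex.Re (D 0 i)); apply: (map_poly_inj toC).
  rewrite map_char_poly cB rmorph_prod/=; apply: eq_bigr => i _.
  rewrite rmorphB/= map_polyX map_polyC/= mxE; congr (_ - _%:P).
  exact/esym/RRe_real.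
have /(congr1 (map_poly toC)) := xgetPex 0 ex.
rewrite -/(eigenvalues A) map_char_poly -/B cB rmorph_prod/=.
under [RHS]eq_bigr do rewrite rmorphB/= map_polyX map_polyC/=.
rewrite -(big_map (fun i => D 0 i) xpredT (fun z => 'X - z%:P)).
rewrite -(big_map (fun i => toC (eigenvalues A 0 i)) xpredT
                  (fun z => 'X - z%:P)).
move=> /prod_XsubC_eq DlE.
apply: (fmorph_inj toC); rewrite rmorph_sum/=.
under eq_bigr do rewrite fmorphV/=.
rewrite -(big_map (fun i => toC (eigenvalues A 0 i)) xpredT (fun z => z^-1)).
rewrite -(perm_big _ DlE) big_map.
rewrite -(trace_map_mx toC) map_invmx -/B.
have D0 i : D 0 i != 0.
  apply: contraTneq uA => Di0; rewrite -(map_unitmx toC) -/B BE.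
  rewrite !unitmx_mul unitmx_inv uQ/= andbT unitmxE det_diag.
  by rewrite unitfE (bigD1 i)//= Di0 mul0r eqxx.
have -> : invmx B = invmx Q *m diag_mx (\row_i (D 0 i)^-1) *m Q.
  have BV : B *m (invmx Q *m diag_mx (\row_i (D 0 i)^-1) *m Q) = 1%:M.
    rewrite BE -!mulmxA (mulmxA Q) mulmxV// mul1mx (mulmxA (diag_mx D)).
    rewrite (_ : diag_mx D *m _ = 1%:M) ?mul1mx ?mulVmx//.
    rewrite mulmx_diag -diag_const_mx; congr diag_mx.
    by apply/rowP => i; rewrite !mxE mulfV.
  have [uB _] := mulmx1_unit BV.
  by rewrite -[RHS](mulKmx uB) BV mulmx1.
rewrite mxtrace_mulC mulmxA mulmxV// mul1mx mxtrace_diag.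
by apply: eq_bigr => i _; rewrite mxE.
Qed.

End eigenvalues.

(** * Integration against a step distribution function *)

Section atomic_measure.
Context {R : realType}.

Lemma measurable_invr : measurable_fun [set: R] (fun x : R => x^-1).
Proof.
(* The power with exponent -1 is the inverse on nonnegative bases, hence the square; at 0 both sides
   vanish because [0^-1 = 0]. *)
have -> : (fun x : R => x^-1) = fun x => x * (x ^+ 2) `^ (-1).
  apply/funext => x; rewrite powR_inv1 ?sqr_ge0//.
  have [->|x0] := eqVneq x 0; first by rewrite invr0 mul0r.
  by rewrite expr2 invfM mulVKf.
apply: measurable_funM; first exact: measurable_id.
apply: (@measurableT_comp _ _ _ _ _ _ (fun a : R => a `^ (-1)) _
  (fun x : R => x ^+ 2)).
  exact: measurable_powR.
by apply: measurable_funX; exact: measurable_id.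
Qed.

(** The Stieltjes measure is [c] times a sum of Dirac masses at the jumps; by uniqueness it suffices
    to compare the two on half-open intervals. *)
Lemma ge0_integral_step_cumulative (f : cumulative R R) (c : {nonneg R}) n
    (l : nat -> R) (g : R -> \bar R) :
  (forall s, f s = c%:num * \sum_(i < n) (l i <= s)%R%:R) ->
  measurable_fun setT g -> (forall x, (0 <= g x)%E) ->
  (\int[lebesgue_stieltjes_measure f]_s g s =
   c%:num%:E * \sum_(i < n) g (l i))%E.
Proof.
move=> fE mg g0.
pose mu : {measure set (measurableTypeR R) -> \bar R} :=
  mscale c (msum (fun i => @dirac _ (measurableTypeR R) (l i) R) n).
have muE A : measurable A -> lebesgue_stieltjes_measure f A = mu A.
  apply: lebesgue_stieltjes_measure_unique => X oX.
  transitivity (wlength f X); first exact: measurable_mu_extE.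
  have [->|[[a b]/= ab ->]] := (ocitvP X).1 oX.
    by rewrite wlength0 measure0.
  rewrite wlength_itv_bnd ?(ltW ab)// !fE -mulrBr -sumrB/= /mscale/= /msum/=.
  rewrite EFinM -sumEFin; congr (_ * _)%E; apply: eq_bigr => i _.
  rewrite diracE /=; congr _%:E.
  (* The point [l i] lies in []a, b]] exactly when its jump is counted at [b] but not at [a]. *)
  case: (leP (l i) a) => [la|al].
    by rewrite (le_trans la (ltW ab)) subrr memNset//= in_itv/= ltNge la.
  case: (leP (l i) b) => lb; rewrite subr0.
    by rewrite mem_set//= in_itv/= al lb.
  by rewrite memNset//= in_itv/= leNgt lb andbF.
rewrite (@eq_measure_integral _ _ _ setT mu)//; last first.
  by move=> A mA _; exact: muE.
rewrite ge0_integral_mscale//; congr (_ * _)%E.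
rewrite ge0_integral_measure_sum//; apply: eq_bigr => i _.
by rewrite integral_dirac// diracT mul1e.
Qed.

(** The reciprocal takes both signs, so positive and negative parts are integrated separately; each
    gives a finite sum, so their difference is well defined. *)
Lemma integral_step_cumulative (f : cumulative R R) (c : {nonneg R}) n
    (l : nat -> R) (g : R -> R) :
  (forall s, f s = c%:num * \sum_(i < n) (l i <= s)%R%:R) ->
  measurable_fun setT g ->
  (\int[lebesgue_stieltjes_measure f]_s (g s)%:E =
   (c%:num * \sum_(i < n) g (l i))%:E)%E.
Proof.
move=> fE mg.
have mg' : measurable_fun setT (EFin \o g) by apply/measurable_EFinP.
rewrite integralE !(ge0_integral_step_cumulative fE)//; last 2 first.
- exact: measurable_funeneg.
- exact: measurable_funepos.
have EmaxE x y : maxe x%:E y%:E = (Num.max x y)%:E by rewrite EFin_max.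
under eq_bigr do rewrite funeposE EmaxE.
under [X in (_ - _ * X)%E]eq_bigr do rewrite funenegE -EFinN EmaxE.
rewrite !sumEFin -!EFinM -EFinB -mulrBr -sumrB; congr (_ * _)%:E.
apply: eq_bigr => i _; case: (leP 0 (g (l i))) => gi.
  by rewrite max_r ?subr0// oppr_le0.
by rewrite sub0r max_l ?opprK// oppr_ge0 ltW.
Qed.

Lemma integral_esd n (A : 'M[R]_n) (g : R -> R) : measurable_fun setT g ->
  (\int[lebesgue_stieltjes_measure (esd A)]_s (g s)%:E =
   (n%:R^-1 * \sum_i g (eigenvalues A 0 i))%:E)%E.
Proof.
(* The jumps are indexed by [nat], so the row is extended by 0; only indices below [n] are ever
   read. *)
move=> mg; pose l k := oapp (eigenvalues A 0) 0 (insub k).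
have lE (i : 'I_n) : l i = eigenvalues A 0 i by rewrite /l valK.
have c0 : 0 <= n%:R^-1 :> R by rewrite invr_ge0.
rewrite (@integral_step_cumulative _ (NngNum c0) n l)//=.
  by congr (_ * _)%:E; apply: eq_bigr => i _; rewrite lE.
move=> s; rewrite [LHS]/(esd A s); congr (_ * _).
by apply: eq_bigr => i _; rewrite lE.
Qed.

End atomic_measure.

(** * Measurability of matrix operations *)

Section matrix_measurability.
Context {R : realType} {d : measure_display} {T : measurableType d}.

Lemma measurable_mx_entry m n i j :
  measurable_fun setT (fun A : 'M[R]_(m, n) => A i j).
Proof.
move=> _ B mB; apply: sub_sigma_algebra; exists i, j.
by exists B => //; rewrite setTI.
Qed.

(** The sigma-algebra on matrices is generated by the entry maps, so only preimages of generators
    have to be checked. *)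
Lemma measurable_mxP m n (f : T -> 'M[R]_(m, n)) :
  measurable_fun setT f <->
  forall i j, measurable_fun setT (fun x => f x i j).
Proof.
split=> [mf i j|mf].
  exact: (measurableT_comp (@measurable_mx_entry m n i j) mf).
apply: (@measurability _ _ _ _ _ _ [set A | exists i j,
  preimage_set_system setT (fun M : 'M[R]_(m, n) => M i j) measurable A]) => //.
move=> _ [B [i [j [C mC <-]]] <-]; rewrite !setTI.
by have := mf i j measurableT _ mC; rewrite setTI.
Qed.

Lemma measurable_mulmx m n p (f : T -> 'M[R]_(m, n)) (g : T -> 'M[R]_(n, p)) :
  measurable_fun setT f -> measurable_fun setT g ->
  measurable_fun setT (fun x => f x *m g x).
Proof.
move=> /measurable_mxP mf /measurable_mxP mg; apply/measurable_mxP => i j.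
under eq_fun do rewrite mxE.
by apply: measurable_sum => k; exact: measurable_funM.
Qed.

Lemma measurable_trmx m n (f : T -> 'M[R]_(m, n)) :
  measurable_fun setT f -> measurable_fun setT (fun x => (f x)^T).
Proof.
move=> /measurable_mxP mf; apply/measurable_mxP => i j.
by under eq_fun do rewrite mxE; exact: mf.
Qed.

Lemma measurable_addmx m n (f g : T -> 'M[R]_(m, n)) :
  measurable_fun setT f -> measurable_fun setT g ->
  measurable_fun setT (fun x => f x + g x).
Proof.
move=> /measurable_mxP mf /measurable_mxP mg; apply/measurable_mxP => i j.
by under eq_fun do rewrite mxE; exact: measurable_funD.
Qed.

Lemma measurable_scalemx m n (c : T -> R) (f : T -> 'M[R]_(m, n)) :
  measurable_fun setT c -> measurable_fun setT f ->
  measurable_fun setT (fun x => c x *: f x).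
Proof.
move=> mc /measurable_mxP mf; apply/measurable_mxP => i j.
by under eq_fun do rewrite mxE; exact: measurable_funM.
Qed.

Lemma measurable_det n (f : T -> 'M[R]_n) :
  measurable_fun setT f -> measurable_fun setT (fun x => \det (f x)).
Proof.
move=> /measurable_mxP mf; apply: measurable_sum => s.
apply: measurable_funM; first exact: measurable_cst.
by apply: measurable_prod => i _; exact: mf.
Qed.

Lemma measurable_adjmx n (f : T -> 'M[R]_n) :
  measurable_fun setT f -> measurable_fun setT (fun x => \adj (f x)).
Proof.
move=> /measurable_mxP mf; apply/measurable_mxP => i j.
under eq_fun do rewrite mxE.
apply: measurable_funM; first exact: measurable_cst.
apply/measurable_det/measurable_mxP => k l.
by under eq_fun do rewrite !mxE; exact: mf.
Qed.

Lemma measurable_mxtrace n (f : T -> 'M[R]_n) :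
  measurable_fun setT f -> measurable_fun setT (fun x => \tr (f x)).
Proof. by move=> /measurable_mxP mf; apply: measurable_sum => i; exact: mf. Qed.

Lemma measurable_rpinv m n (f : T -> 'M[R]_(m, n)) :
  measurable_fun setT f -> measurable_fun setT (fun x => rpinv (f x)).
Proof.
move=> mf; have mG : measurable_fun setT (fun x => f x *m (f x)^T).
  by apply: measurable_mulmx => //; exact: measurable_trmx.
apply: measurable_scalemx.
  exact: (measurableT_comp measurable_invr (measurable_det mG)).
by apply: measurable_mulmx; [exact: measurable_trmx|exact: measurable_adjmx].
Qed.

Lemma measurable_l2norm_sqr n (f : T -> 'cV[R]_n) :
  measurable_fun setT f -> measurable_fun setT (fun x => l2norm (f x) ^+ 2).
Proof.
move=> /measurable_mxP mf; under eq_fun do rewrite l2norm_sqr.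
by apply: measurable_sum => i; apply/measurable_funX/mf.
Qed.

End matrix_measurability.

(** * Null sets and independence *)

Section integration.
Context {R : realType} {d : measure_display} {T : measurableType d}.

Import HBNNSimple.

Lemma integral_eq_off_null (mu : {measure set T -> \bar R}) (D N : set T)
    (f g : T -> \bar R) :
  measurable N -> mu N = 0%E -> (forall x, ~ N x -> f x = g x) ->
  (\int[mu]_(x in D) f x = \int[mu]_(x in D) g x)%E.
Proof.
(* No measurability of [f] and [g] is assumed: the integral of a nonnegative
   function is the supremum of the integrals of the simple functions below it,
   and these may be cut off on [N]. *)
move=> mN N0.
have ge0_le (f1 f2 : T -> \bar R) : (forall x, 0 <= f1 x)%E ->
    (forall x, 0 <= f2 x)%E -> (forall x, ~ N x -> f1 x = f2 x) ->
    (\int[mu]_(x in D) f1 x <= \int[mu]_(x in D) f2 x)%E.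
  move=> f10 f20 f12; rewrite integral_mkcond [leRHS]integral_mkcond.
  have p0 (h : T -> \bar R) x : (forall x, 0 <= h x)%E -> (0 <= (h \_ D) x)%E.
    by move=> h0; rewrite patchE; case: ifP.
  rewrite !ge0_integralTE//; try by move=> x; exact: p0.
  apply: ge_ereal_sup => _ /= [h hf <-].
  pose h' := proj_nnsfun h (measurableC mN).
  have -> : sintegral mu h = sintegral mu h'.
    rewrite -!integralT_nnsfun; apply: ge0_ae_eq_integral => //.
    - exact/measurable_EFinP.
    - exact/measurable_EFinP.
    - by move=> x _; rewrite lee_fin.
    - by move=> x _; rewrite lee_fin.
    exists N; split => // x /= /not_implyP[_ hh']; apply: contrapT => Nx.
    by apply: hh'; rewrite /= mindicE mem_set ?mulr1.
  apply: ereal_sup_ubound => /=; exists h' => // x /=.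
  rewrite mindicE; case: (pselect (N x)) => Nx.
    by rewrite memNset ?mulr0 ?p0//=; apply.
  rewrite mem_set// mulr1; apply: le_trans (hf x) _.
  by rewrite !patchE; case: ifP => // _; rewrite f12.
move=> fg; rewrite integralE [RHS]integralE; congr (_ - _)%E; apply/eqP;
  rewrite eq_le !ge0_le// => x Nx; by rewrite ?(funeposE, funenegE) fg.
Qed.

Section independence.
Variables (P : probability T R).
Context {d1 d2 : measure_display} {T1 : measurableType d1}
  {T2 : measurableType d2}.
Variables (U : T -> T1) (V : T -> T2).
Hypotheses (mU : measurable_fun setT U) (mV : measurable_fun setT V).

(** Independence says that the joint law agrees with the product law on rectangles, hence
    everywhere; Tonelli then splits the integral, with [U] averaged first. *)
Lemma ge0_integral_independent (F : T1 * T2 -> \bar R) :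
  independent P U V -> measurable_fun setT F -> (forall z, 0 <= F z)%E ->
  (\int[P]_w F (U w, V w) = \int[P]_w \int[P]_w' F (U w', V w))%E.
Proof.
move=> UV mF F0.
pose U' : {mfun T >-> T1} := HB.pack U (isMeasurableFun.Build _ _ _ _ U mU).
pose V' : {mfun T >-> T2} := HB.pack V (isMeasurableFun.Build _ _ _ _ V mV).
pose W w := (U w, V w).
have mW : measurable_fun setT W by exact: measurable_fun_pair.
pose W' : {mfun T >-> (T1 * T2)%type} :=
  HB.pack W (isMeasurableFun.Build _ _ _ _ W mW).
transitivity (\int[distribution P W']_z F z)%E.
  by rewrite ge0_integral_distribution.
rewrite (@eq_measure_integral _ _ _ setT
    (distribution P U' \x distribution P V')%E); last first.
  by move=> A mA _; apply/esym; exact: product_measure_unique.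
rewrite fubini_tonelli2// ge0_integral_distribution//.
- apply: eq_integral => w _; rewrite /= /fubini_G ge0_integral_distribution//.
  exact: measurableT_comp.
- exact: measurable_fun_fubini_tonelli_G.
- by move=> z; exact: integral_ge0.
Qed.

End independence.
End integration.

(** * Means of quadratic functions of a random vector *)

Section moments.
Context {R : realType} {d : measure_display} {T : measurableType d}.
Variable P : probability T R.

(** Integrability and the value are kept together so that the linearity rules compose without side
    conditions. *)
Definition has_mean (f : T -> R) (v : R) :=
  P.-integrable setT (EFin \o f) /\ (\int[P]_w (f w)%:E = v%:E)%E.

Lemma has_mean_cst c : has_mean (fun=> c) c.
Proof.
split; first by apply: (@finite_measure_integrable_cst _ _ _ P).
rewrite integral_cst// -[RHS]mule1; congr (_ * _)%E; exact: probability_setT.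
Qed.

Lemma has_meanD f g u v : has_mean f u -> has_mean g v ->
  has_mean (fun w => f w + g w) (u + v).
Proof.
move=> [If Ef] [Ig Eg]; split.
  exact: (integrableD measurableT If Ig).
by under eq_integral => w _ do rewrite EFinD; rewrite integralD// Ef Eg.
Qed.

Lemma has_meanZ c f v : has_mean f v -> has_mean (fun w => c * f w) (c * v).
Proof.
move=> [If Ef]; split.
  exact: (integrableZl measurableT c If).
by under eq_integral => w _ do rewrite EFinM; rewrite integralZl// Ef.
Qed.

Lemma has_mean_sum (I : finType) (f : I -> T -> R) (v : I -> R) :
  (forall i, has_mean (f i) (v i)) ->
  has_mean (fun w => \sum_i f i w) (\sum_i v i).
Proof.
move=> H; split.
  rewrite (_ : EFin \o _ = fun w => \sum_i (f i w)%:E)%E; last first.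
    by apply/funext => w; rewrite /= sumEFin.
  by apply: integrable_sum => // i _; exact: (H i).1.
under eq_integral => w _ do rewrite -sumEFin.
rewrite integral_sum//; last by move=> i; exact: (H i).1.
by rewrite -sumEFin; apply: eq_bigr => i _; exact: (H i).2.
Qed.

Lemma has_mean_mx m n (M : T -> 'M[R]_(m, n)) i j :
  mx_integrable P M -> has_mean (fun w => M w i j) (mx_expectation P M i j).
Proof.
move=> IM; split; first exact: IM.
by rewrite mxE unlock fineK//; exact: integrable_fin_num (IM i j).
Qed.

Section quadratic.
Variables (m k : nat) (e : T -> 'cV[R]_k) (K : 'M[R]_(m, k)).
Hypothesis e2_int : mx_integrable P (fun w => e w *m (e w)^T).

Let Omega := mx_expectation P (fun w => e w *m (e w)^T).

Lemma has_mean_l2norm_sqr :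
  has_mean (fun w => l2norm (K *m e w) ^+ 2) (\tr (K *m Omega *m K^T)).
Proof.
have -> : (fun w => l2norm (K *m e w) ^+ 2) =
    fun w => \sum_i \sum_l \sum_j (K i l * K i j) * (e w *m (e w)^T) j l.
  apply/funext => w; rewrite l2norm_sqr; apply: eq_bigr => i _.
  rewrite expr2 {1}mxE mulr_suml; apply: eq_bigr => l _.
  rewrite mxE mulr_sumr; apply: eq_bigr => j _.
  by rewrite mxE big_ord1 mxE mulrACA [X in _ = _ * X]mulrC.
have -> : \tr (K *m Omega *m K^T) =
    \sum_i \sum_l \sum_j (K i l * K i j) * Omega j l.
  apply: eq_bigr => i _; rewrite mxE; apply: eq_bigr => l _.
  rewrite mxE mulr_suml; apply: eq_bigr => j _.
  by rewrite [K^T l i]mxE mulrC mulrA.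
do 3! apply: has_mean_sum => ? /=.
by apply: has_meanZ; exact: has_mean_mx.
Qed.

(** In the expanded square the cross term is linear in [e], so it has mean zero. *)
Lemma has_mean_l2norm_sqr_shift (a : 'cV[R]_m) :
  mx_integrable P e -> mx_expectation P e = 0 ->
  has_mean (fun w => l2norm (a + K *m e w) ^+ 2)
    (l2norm a ^+ 2 + \tr (K *m Omega *m K^T)).
Proof.
move=> e_int e0.
have -> : (fun w => l2norm (a + K *m e w) ^+ 2) =
    fun w => (l2norm a ^+ 2 + \sum_i \sum_j (2 * a i 0 * K i j) * e w j 0)
             + l2norm (K *m e w) ^+ 2.
  apply/funext => w; rewrite !l2norm_sqr -!big_split; apply: eq_bigr => i _/=.
  under [X in _ = _ + X + _]eq_bigr => j _ do rewrite -mulrA.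
  by rewrite -mulr_sumr !mxE; ring.
apply: has_meanD has_mean_l2norm_sqr.
rewrite -[X in has_mean _ X]addr0; apply: has_meanD; first exact: has_mean_cst.
rewrite -[X in has_mean _ X](_ : \sum_i \sum_j (2 * a i 0 * K i j) * 0 = 0).
  apply: has_mean_sum => i /=; apply: has_mean_sum => j /=; apply: has_meanZ.
  have -> : 0 = mx_expectation P e j 0 by rewrite e0 mxE.
  exact: has_mean_mx.
by rewrite big1// => i _; rewrite big1// => j _; rewrite mulr0.
Qed.

End quadratic.

(** Each product [b_i b_j] is dominated by the squared norm, so a finite mean of the latter makes
    the second moment matrix of [beta] integrable. *)
Lemma mx_integrable_sqr p (b : T -> 'cV[R]_p) (v : R) :
  measurable_fun setT b -> ('E_P[fun w => (l2norm (b w) ^+ 2)%R] = v%:E)%E ->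
  mx_integrable P (fun w => b w *m (b w)^T).
Proof.
move=> mb; rewrite unlock => Ev i j; have /measurable_mxP mb' := mb.
have mn := measurable_l2norm_sqr mb.
apply: (@le_integrable _ _ _ _ _ measurableT _
  (fun w => (l2norm (b w) ^+ 2)%:E)).
- apply/measurable_EFinP; under eq_fun do rewrite mxE big_ord1 mxE.
  exact: measurable_funM.
- move=> w _; rewrite /= !lee_fin mxE big_ord1 mxE normrM.
  rewrite [leRHS]ger0_norm ?sqr_ge0// l2norm_sqr.
  have le_sum l : `|b w l 0| ^+ 2 <= \sum_i b w i 0 ^+ 2.
    rewrite -normrX ger0_norm ?sqr_ge0// (bigD1 l)//= lerDl.
    by rewrite sumr_ge0// => ? _; exact: sqr_ge0.
  (* Twice the product of two absolute values is at most the sum of their squares, and each square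
     is at most the squared norm. *)
  have := le_sum i; have := le_sum j.
  have : 0 <= (`|b w i 0| - `|b w j 0|) ^+ 2 by exact: sqr_ge0.
  by nra.
- apply/integrableP; split; first exact/measurable_EFinP.
  under eq_integral => w _ do rewrite gee0_abs ?lee_fin ?sqr_ge0//.
  by rewrite Ev ltry.
Qed.

End moments.

(** * Conditional risk given [(X, beta)] *)

Section conditional_risk.
Context {R : realType} {n p : nat}.

Definition bias (z : 'M[R]_(n, p) * 'cV[R]_p) : 'cV[R]_p :=
  (rpinv z.1 *m z.1 - 1%:M) *m z.2.

Definition variance (Omega : 'M[R]_n) (x : 'M[R]_(n, p)) : R :=
  \tr (rpinv x *m Omega *m (rpinv x)^T).

(** Each diagonal entry is the quadratic form of [Omega] at a row of [rpinv x]; such a row may be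
    zero. *)
Lemma variance_ge0 Omega x : pos_def Omega -> 0 <= variance Omega x.
Proof.
move=> [_ Op]; apply: sumr_ge0 => i _.
have -> : (rpinv x *m Omega *m (rpinv x)^T) i i =
    ((row i (rpinv x))^T^T *m Omega *m (row i (rpinv x))^T) 0 0.
  rewrite trmxK -row_mul mxE [RHS]mxE; apply: eq_bigr => k _.
  by rewrite !mxE.
by have [->|/Op/ltW//] := eqVneq (row i (rpinv x))^T 0; rewrite mulmx0 mxE.
Qed.

Lemma measurable_bias : measurable_fun setT bias.
Proof.
have mf : measurable_fun setT (fun z : 'M[R]_(n, p) * 'cV[R]_p => z.1).
  exact: measurable_fst.
apply: measurable_mulmx; last exact: measurable_snd.
apply: measurable_addmx; last exact: measurable_cst.
by apply: measurable_mulmx => //; exact: measurable_rpinv.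
Qed.

Lemma measurable_variance Omega : measurable_fun setT (variance Omega).
Proof.
have mK : measurable_fun setT (@rpinv R n p).
  by apply: measurable_rpinv; exact: measurable_id.
apply/measurable_mxtrace/measurable_mulmx; last exact: measurable_trmx.
by apply: measurable_mulmx => //; exact: measurable_cst.
Qed.

Context {d : measure_display} {T : measurableType d}.
Variables (P : probability T R) (X : T -> 'M[R]_(n, p))
  (beta : T -> 'cV[R]_p) (eps : T -> 'cV[R]_n).
Hypotheses (mX : measurable_fun setT X) (mb : measurable_fun setT beta)
  (me : measurable_fun setT eps).
Hypothesis X_rank : {ae P, forall w, \rank (X w) = n}.

(** The exceptional set can be taken measurable: rank deficiency is the vanishing of the Gram
    determinant, a polynomial in the entries. *)
Lemma ae_rank_null : exists N : set T,
  [/\ measurable N, P N = 0%E & forall w, ~ N w -> \rank (X w) = n].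
Proof.
exists [set w | \det (X w *m (X w)^T) = 0].
have mN : measurable [set w | \det (X w *m (X w)^T) = 0].
  have mG : measurable_fun setT (fun w => \det (X w *m (X w)^T)).
    apply: measurable_det; apply: measurable_mulmx => //.
    exact: measurable_trmx.
  by have := mG measurableT _ (measurable_set1 0); rewrite setTI.
have detE w : \det (X w *m (X w)^T) <> 0 <-> \rank (X w) = n.
  split=> [/eqP|rX]; first by rewrite -unitfE -unitmxE gram_unitmx => /eqP.
  by apply/eqP; rewrite -unitfE -unitmxE gram_unitmx rX.
split=> // [|w]; last by move/detE.
apply/(negligibleP P mN); apply: negligibleS X_rank => w /= G0.
by move/detE; apply.
Qed.

Variable Omega : 'M[R]_n.
Hypotheses (eps_indep : independent P eps (fun w => (X w, beta w)))
  (eps_int : mx_integrable P eps) (eps_mean0 : mx_expectation P eps = 0)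
  (Omega_fin : mx_integrable P (fun w => eps w *m (eps w)^T))
  (OmegaE : Omega = mx_expectation P (fun w => eps w *m (eps w)^T))
  (Omega_pd : pos_def Omega).

Let U w := (X w, beta w).
Let f w := let y := X w *m beta w + eps w in
  (l2norm (ridgeless (X w) y - beta w) ^+ 2)%:E.
Let g w := (l2norm (bias (U w)) ^+ 2 + variance Omega (X w))%:E.

Let mU : measurable_fun setT U. Proof. exact: measurable_fun_pair. Qed.

(** Since [eps] is independent of [U], it can be averaged with [U] frozen; the mean of the shifted
    quadratic form is then bias squared plus variance. *)
Lemma is_cond_expectation_risk : is_cond_expectation P U f g.
Proof.
(* [g] factors as [h] after [U], which makes it measurable for the sigma-algebra generated by
   [U]. *)
pose h (z : 'M[R]_(n, p) * 'cV[R]_p) :=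
  (l2norm (bias z) ^+ 2 + variance Omega z.1)%:E.
have mh : measurable_fun setT h.
  apply/measurable_EFinP; apply: measurable_funD.
    by apply: measurable_l2norm_sqr; exact: measurable_bias.
  by apply: (measurableT_comp (measurable_variance Omega)).
split=> [_ B mB|w|_ [B mB <-]].
- rewrite setTI; exists (h @^-1` B); last by rewrite setTI.
  by rewrite -[X in measurable X]setTI; exact: mh.
- by rewrite lee_fin addr_ge0 ?sqr_ge0 ?variance_ge0.
rewrite setTI.
have [N [mN N0 rN]] := ae_rank_null.
pose F (z : 'cV[R]_n * ('M[R]_(n, p) * 'cV[R]_p)) :=
  (l2norm (bias z.2 + rpinv z.2.1 *m z.1) ^+ 2)%:E.
have mF : measurable_fun setT F.
  apply/measurable_EFinP/measurable_l2norm_sqr/measurable_addmx.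
    by apply: (measurableT_comp measurable_bias); exact: measurable_snd.
  apply: measurable_mulmx; last exact: measurable_fst.
  apply: measurable_rpinv.
  by apply: (measurableT_comp measurable_fst); exact: measurable_snd.
(* [mp_inverse] is defined by choice, so it is replaced off a null set by the measurable [rpinv]. *)
rewrite [RHS](integral_eq_off_null _ mN N0 (g := fun w => F (eps w, U w)));
    last first.
  move=> w /rN rX; congr (l2norm _ ^+ 2)%:E; rewrite /ridgeless /bias/=.
  by rewrite mp_inverse_rpinv// mulmxDr mulmxBl mulmxA mul1mx addrAC.
(* Restricting to an event of [U] is absorbed into the integrand, so that independence applies on
   the whole space. *)
pose FB := F \_ (snd @^-1` B).
have mFB : measurable_fun setT FB.
  apply/(measurable_restrictT _ _).1.
    by rewrite -[X in measurable X]setTI; exact: measurable_snd.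
  exact: measurable_funTS.
rewrite [RHS]integral_mkcond [LHS]integral_mkcond.
transitivity (\int[P]_w FB (eps w, U w))%E; last first.
  by apply: eq_integral => w _; rewrite /FB !patchE.
rewrite ge0_integral_independent//; last first.
  by move=> z; rewrite /FB patchE; case: ifP => // _; rewrite lee_fin sqr_ge0.
apply: eq_integral => w _; rewrite patchE.
have FBE w' : FB (eps w', U w) =
    if w \in U @^-1` B then F (eps w', U w) else 0%E by rewrite /FB patchE.
under eq_integral => w' _ do rewrite FBE.
case: ifP => _; last by rewrite integral0.
have [_ ->] := has_mean_l2norm_sqr_shift (rpinv (X w)) Omega_fin (bias (U w))
  eps_int eps_mean0.
by rewrite -OmegaE.
Qed.

(** [cond_expectation] picks some version, one exists by the previous lemma, and any two versions
    have the same integral over the whole space. *)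
Lemma estimation_riskE : estimation_risk P X beta eps = (\int[P]_w g w)%E.
Proof.
have [_ _ gE] := is_cond_expectation_risk.
have [_ _ cE] : is_cond_expectation P U f (cond_expectation P U f).
  exact: xgetPex _ (ex_intro _ _ is_cond_expectation_risk).
have sT : g_sigma_algebra_preimage U setT by exists setT; rewrite ?setTI.
by rewrite /estimation_risk /cond_estimation_risk cE// gE.
Qed.

End conditional_risk.

(** * Mean of the squared bias *)

Section expected_bias.
Context {R : realType} {n p : nat} {d : measure_display} {T : measurableType d}.
Variables (P : probability T R) (X : T -> 'M[R]_(n, p)) (beta : T -> 'cV[R]_p)
  (r : R).
Hypotheses (mX : measurable_fun setT X) (mb : measurable_fun setT beta).
Hypotheses (X_rank : {ae P, forall w, \rank (X w) = n})
  (beta_indep : independent P beta X)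
  (r2E : 'E_P[fun w => (l2norm (beta w) ^+ 2)%R]%E = (r ^+ 2)%:E)
  (beta_cov : mx_expectation P (fun w => beta w *m (beta w)^T)
              = (r ^+ 2 / p%:R)%:M).

(** With [X] frozen, averaging over [beta] leaves [r ^+ 2 / p%:R] times the squared Frobenius norm
    of [rpinv X *m X - 1%:M], which is almost surely the constant [p - n]. *)
Lemma integral_bias_sqr :
  (\int[P]_w (l2norm (bias (X w, beta w)) ^+ 2)%:E =
   (r ^+ 2 / p%:R * (p%:R - n%:R))%:E)%E.
Proof.
pose F (z : 'cV[R]_p * 'M[R]_(n, p)) := (l2norm (bias (z.2, z.1)) ^+ 2)%:E.
have mF : measurable_fun setT F.
  apply/measurable_EFinP/measurable_l2norm_sqr.
  apply: (measurableT_comp measurable_bias).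
  by apply: measurable_fun_pair; [exact: measurable_snd|exact: measurable_fst].
rewrite (ge0_integral_independent (F := F) mb mX)//; last first.
  by move=> z; rewrite lee_fin sqr_ge0.
have [N [mN N0 rN]] := ae_rank_null mX X_rank.
rewrite (integral_eq_off_null _ mN N0
    (g := fun=> (r ^+ 2 / p%:R * (p%:R - n%:R))%:E)) => [|w /rN rX].
  rewrite integral_cst// -[RHS]mule1; congr (_ * _)%E; exact: probability_setT.
have [_] := has_mean_l2norm_sqr (rpinv (X w) *m X w - 1%:M)
  (mx_integrable_sqr mb r2E).
rewrite beta_cov mul_mx_scalar -(scalemxAl (r ^+ 2 / p%:R)) mxtraceZ.
by rewrite -sum_sqr_mxE mxtrace_rowspace_compl.
Qed.

End expected_bias.

(** * Averaging the variance by left-sphericity *)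

Section spherical.
Context {R : realType}.

(** This is the inverse of [x *m x^T] at full row rank; as a Gram matrix it has a nonnegative trace
    for every [x]. *)
Definition gram_inv n p (x : 'M[R]_(n, p)) : 'M[R]_n := (rpinv x)^T *m rpinv x.

Lemma orthogonal_mxT n (O : 'M[R]_n) : orthogonal_mx O -> O *m O^T = 1%:M.
Proof. exact: mulmx1C. Qed.

Lemma rpinv_orthogonal n p (O : 'M[R]_n) (x : 'M[R]_(n, p)) :
  orthogonal_mx O -> rpinv (O *m x) = rpinv x *m O^T.
Proof.
move=> oO; have oOT := orthogonal_mxT oO.
have [rx|rx] := eqVneq (\rank x) n.
  have rOx : \rank (O *m x) = n.
    have [uO _] := mulmx1_unit oOT.
    by rewrite eqmxMfull ?row_full_unit.
  have uG : x *m x^T \in unitmx by rewrite gram_unitmx rx.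
  rewrite !rpinvE// trmx_mul.
  have -> : O *m x *m (x^T *m O^T) = O *m (x *m x^T) *m O^T.
    by rewrite !mulmxA.
  move: (x *m x^T) uG => G uG.
  have HV : O *m G *m O^T *m (O *m invmx G *m O^T) = 1%:M.
    by rewrite !mulmxA -(mulmxA _ O^T) oO mulmx1 -(mulmxA _ G) mulmxV// mulmx1.
  have [uH _] := mulmx1_unit HV.
  have -> : invmx (O *m G *m O^T) = O *m invmx G *m O^T.
    by rewrite -[RHS](mulKmx uH) HV mulmx1.
  by rewrite !mulmxA -(mulmxA _ O^T) oO mulmx1.
(* In the rank-deficient case both Gram determinants vanish and both sides are 0, so the identity
   holds for every [x]. *)
rewrite /rpinv !trmx_mul mulmxA -(mulmxA O) !det_mulmx.
have /eqP -> : \det (x *m x^T) == 0.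
  by rewrite -[_ == 0]negbK -unitfE -unitmxE gram_unitmx.
by rewrite mulr0 mul0r invr0 !scale0r mul0mx.
Qed.

Lemma variance_orthogonal n p (O Omega : 'M[R]_n) (x : 'M[R]_(n, p)) :
  orthogonal_mx O ->
  variance Omega (O *m x) = \tr (Omega *m (O *m gram_inv x *m O^T)).
Proof.
move=> oO; rewrite /variance rpinv_orthogonal// trmx_mul trmxK.
by rewrite -(mulmxA _ Omega) mxtrace_mulC /gram_inv !mulmxA.
Qed.

Section signed_shifts.
Variable n : nat.

(** Addition in ['I_n.+1] is modulo [n.+1]: this is a cyclic permutation matrix whose rows carry the
    signs [s]. *)
Definition signed_shift (s : {ffun 'I_n.+1 -> bool}) (k : 'I_n.+1) :
    'M[R]_n.+1 :=
  \matrix_(i, j) ((-1) ^+ s i *+ (j == i + k)).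

Lemma signed_shift_conj s k (S : 'M[R]_n.+1) i j :
  (signed_shift s k *m S *m (signed_shift s k)^T) i j =
  (-1) ^+ s i * (-1) ^+ s j * S (i + k) (j + k).
Proof.
rewrite mxE (bigD1 (j + k))//= big1 => [|l ljk]; last first.
  by rewrite [X in _ * X]mxE [X in _ * X]mxE (negbTE ljk) mulr0n mulr0.
rewrite addr0 [X in _ * X]mxE [X in _ * X]mxE eqxx mulr1n.
rewrite mxE (bigD1 (i + k))//= big1 => [|l lik]; last first.
  by rewrite mxE (negbTE lik) mulr0n mul0r.
by rewrite addr0 mxE eqxx mulr1n mulrAC.
Qed.

Lemma signed_shift_orthogonal s k : orthogonal_mx (signed_shift s k).
Proof.
apply: mulmx1C; apply/matrixP => i j.
rewrite -{1}[signed_shift s k]mulmx1 signed_shift_conj !mxE (inj_eq (addIr _)).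
by case: eqVneq => [->|_]; rewrite ?mulr0// -expr2 sqrr_sign mulr1.
Qed.

(** For [i] different from [j], flipping the sign at [i] is an involution that negates each summand,
    so the sum equals its opposite. *)
Lemma sum_sign (i j : 'I_n.+1) :
  \sum_(s : {ffun 'I_n.+1 -> bool}) (-1) ^+ s i * (-1) ^+ s j =
  (2 ^ n.+1)%:R *+ (i == j) :> R.
Proof.
have [<-|ij] := eqVneq i j.
  under eq_bigr do rewrite -expr2 sqrr_sign.
  by rewrite sumr_const card_ffun card_bool card_ord.
pose flip (s : {ffun 'I_n.+1 -> bool}) := [ffun l => s l (+) (l == i)].
have flipK : involutive flip.
  by move=> s; apply/ffunP => l; rewrite !ffunE -addbA addbb addbF.
set S := (X in X = _); suff : S = - S.
  by move/eqP; rewrite -addr_eq0 -mulr2n mulrn_eq0 => /eqP.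
rewrite {1}/S (reindex_inj (inv_inj flipK)) -sumrN; apply: eq_bigr => s _.
rewrite !ffunE eqxx (negbTE _ : j == i = false) 1?eq_sym// addbF signr_addb.
by rewrite mulrN1 !mulNr.
Qed.

(** Summing over signs kills the off-diagonal entries; summing over shifts carries each diagonal
    position through the whole diagonal of [S]. *)
Lemma sum_signed_shift_conj (S : 'M[R]_n.+1) :
  \sum_s \sum_k signed_shift s k *m S *m (signed_shift s k)^T =
  ((2 ^ n.+1)%:R * \tr S)%:M.
Proof.
apply/matrixP => i j; rewrite summxE.
under eq_bigr => s _.
  rewrite summxE; under eq_bigr do rewrite signed_shift_conj.
  rewrite -mulr_sumr; over.
rewrite -mulr_suml sum_sign [RHS]mxE.
case: eqVneq => [<-|_]; last by rewrite mul0r.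
by congr (_ * _); rewrite [RHS](reindex_inj (addrI i)).
Qed.

End signed_shifts.

Context {d : measure_display} {T : measurableType d}.

Variable P : probability T R.

Lemma ge0_integral_spherical n p (X : T -> 'M[R]_(n, p)) (O : 'M[R]_n)
    (phi : 'M[R]_(n, p) -> \bar R) :
  measurable_fun setT X -> left_spherical P X -> orthogonal_mx O ->
  measurable_fun setT phi -> (forall x, 0 <= phi x)%E ->
  (\int[P]_w phi (O *m X w) = \int[P]_w phi (X w))%E.
Proof.
move=> mX spX oO mphi phi0; pose Y w := O *m X w.
have mY : measurable_fun setT Y.
  by apply: measurable_mulmx => //; exact: measurable_cst.
pose X' : {mfun T >-> 'M[R]_(n, p)} :=
  HB.pack X (isMeasurableFun.Build _ _ _ _ X mX).
pose Y' : {mfun T >-> 'M[R]_(n, p)} :=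
  HB.pack Y (isMeasurableFun.Build _ _ _ _ Y mY).
transitivity (\int[distribution P Y']_x phi x)%E.
  by rewrite ge0_integral_distribution.
rewrite (@eq_measure_integral _ _ _ setT (distribution P X')).
  by rewrite ge0_integral_distribution.
by move=> A mA _; exact: spX.
Qed.

Lemma integral_variance n p (X : T -> 'M[R]_(n, p)) (Omega : 'M[R]_n) :
  (0 < n)%N -> measurable_fun setT X -> left_spherical P X -> pos_def Omega ->
  (\int[P]_w (variance Omega (X w))%:E =
   (\tr Omega / n%:R)%:E * \int[P]_w (\tr (gram_inv (X w)))%:E)%E.
Proof.
(* Cyclic shifts need the additive group on ['I_n.+1]. *)
case: n X Omega => [//|n] X Omega _ mX spX Op.
have mtr : measurable_fun setT (fun w => \tr (gram_inv (X w))).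
  have mK := measurable_rpinv mX.
  by apply/measurable_mxtrace/measurable_mulmx => //; exact: measurable_trmx.
have tr0 w : 0 <= \tr (gram_inv (X w)).
  rewrite /gram_inv mxtrace_mulC -sum_sqr_mxE.
  by do 2! apply: sumr_ge0 => ? _; exact: sqr_ge0.
have trO : 0 <= \tr Omega / n.+1%:R.
  rewrite divr_ge0//; apply: sumr_ge0 => i _.
  have := Op.2 (delta_mx i 0); rewrite trmx_delta -rowE -colE !mxE.
  move=> H; apply/ltW/H; apply/eqP => /matrixP/(_ i 0)/eqP.
  by rewrite !mxE !eqxx oner_eq0.
(* The uniform weight on the pairs of signs and shift. *)
pose c : R := (#|{: {ffun 'I_n.+1 -> bool} * 'I_n.+1}|%:R)^-1.
have cN : \sum_(z : {ffun 'I_n.+1 -> bool} * 'I_n.+1) c = 1.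
  rewrite sumr_const -[c]mul1r -mulrnAl divff// card_prod card_ord card_ffun.
  by rewrite card_bool card_ord pnatr_eq0 muln_eq0 expn_eq0.
have c0 : 0 <= c by rewrite invr_ge0.
have sumE x : \sum_(z : {ffun 'I_n.+1 -> bool} * 'I_n.+1)
    c * variance Omega (signed_shift z.1 z.2 *m x) =
    \tr Omega / n.+1%:R * \tr (gram_inv x).
  rewrite -mulr_sumr.
  under eq_bigr do
    rewrite (variance_orthogonal _ _ (signed_shift_orthogonal _ _)).
  rewrite -(raddf_sum (@mxtrace R n.+1)) -mulmx_sumr.
  rewrite -(pair_bigA _ (fun s k =>
    signed_shift s k *m gram_inv x *m (signed_shift s k)^T))/=.
  rewrite sum_signed_shift_conj mul_mx_scalar mxtraceZ.
  rewrite /c card_prod card_ord card_ffun card_bool card_ord natrM.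
  have : (2 ^ n.+1)%:R != 0 :> R by rewrite pnatr_eq0 expn_eq0.
  have : n.+1%:R != 0 :> R by rewrite pnatr_eq0.
  by move=> *; field; apply/andP.
rewrite -ge0_integralZl//; last 2 first.
- exact/measurable_EFinP.
- by move=> w _; rewrite lee_fin.
under [RHS]eq_integral => w _ do rewrite -EFinM -sumE -sumEFin.
have mvar (O : 'M[R]_n.+1) :
    measurable_fun setT (fun w => (variance Omega (O *m X w))%:E).
  apply/measurable_EFinP/(measurableT_comp (measurable_variance Omega)).
  by apply: measurable_mulmx => //; exact: measurable_cst.
rewrite ge0_integral_sum//; last 2 first.
- move=> z; apply/measurable_EFinP/measurable_funM; first exact: measurable_cst.
  by have /measurable_EFinP := mvar (signed_shift z.1 z.2).
- by move=> z w _; rewrite lee_fin mulr_ge0// variance_ge0.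
(* By sphericity every term of the average has the same integral as the unrotated variance, and the
   weights add up to 1. *)
under eq_bigr => z _.
  under eq_integral => w _ do rewrite EFinM.
  rewrite ge0_integralZl//; last by move=> w _; rewrite lee_fin variance_ge0.
  rewrite (ge0_integral_spherical (phi := fun x => (variance Omega x)%:E))//.
  - over.
  - exact: signed_shift_orthogonal.
  - by apply/measurable_EFinP; exact: measurable_variance.
  - by move=> x; rewrite lee_fin variance_ge0.
by rewrite -ge0_sume_distrl// sumEFin cN mul1e.
Qed.

End spherical.
Theorem corollary4p2 (R : realType) (d : measure_display)
    (T : measurableType d) (P : probability T R) (n p : nat)
    (X : {RV P >-> 'M[R]_(n, p)}) (beta : {RV P >-> 'cV[R]_p})
    (eps : {RV P >-> 'cV[R]_n}) (Omega : 'M[R]_n) (r : R)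
    (n_ge1 : (1 <= n)%N) (n_lt_p : (n < p)%N)
    (eps_indep : independent P eps (fun w => (X w, beta w)))
    (eps_int : mx_integrable P eps)
    (eps_mean0 : mx_expectation P eps = 0)
    (Omega_fin : mx_integrable P (fun w => eps w *m (eps w)^T))
    (OmegaE : Omega = mx_expectation P (fun w => eps w *m (eps w)^T))
    (Omega_pd : pos_def Omega)
    (X_spherical : left_spherical P X)
    (X_rank : {ae P, forall w, \rank (X w) = n})
    (beta_indep : independent P beta X)
    (r2E : 'E_P[fun w => (l2norm (beta w) ^+ 2)%R]%E = (r ^+ 2)%:E)
    (beta_cov : mx_expectation P (fun w => beta w *m (beta w)^T)
                = (r ^+ 2 / p%:R)%:M) :
  (estimation_risk P X beta eps =
     (r ^+ 2 * (1 - n%:R / p%:R))%:E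
     + (\tr Omega / n%:R)%:E
       * \int[P]_w \int[lebesgue_stieltjes_measure
                          (esd (n%:R^-1 *: (X w *m (X w)^T)))]_s (s^-1)%:E)%E.
Proof.
have mX : measurable_fun setT X by exact: measurable_funPT.
have mb : measurable_fun setT beta by exact: measurable_funPT.
have me : measurable_fun setT eps by exact: measurable_funPT.
have n0 : n%:R != 0 :> R by rewrite pnatr_eq0 -lt0n.
have p0 : p%:R != 0 :> R by rewrite pnatr_eq0 -lt0n (leq_ltn_trans _ n_lt_p).
rewrite (estimation_riskE mX mb me X_rank eps_indep eps_int eps_mean0 Omega_fin
  OmegaE Omega_pd).
under eq_integral => w _ do rewrite EFinD.
rewrite ge0_integralD//; last 4 first.
- by move=> w _; rewrite lee_fin sqr_ge0.
- apply/measurable_EFinP/measurable_l2norm_sqr.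
  apply: (measurableT_comp measurable_bias); exact: measurable_fun_pair.
- by move=> w _; rewrite lee_fin variance_ge0.
- by apply/measurable_EFinP/(measurableT_comp (measurable_variance Omega)).
rewrite (integral_bias_sqr mX mb X_rank beta_indep r2E beta_cov).
rewrite (integral_variance n_ge1 mX X_spherical Omega_pd).
congr (_%:E + _ * _)%E; first by field.
have [N [mN N0 rN]] := ae_rank_null mX X_rank.
(* What remains is pointwise at full rank: the factor [n] from inverting the scaled Gram matrix
   cancels the [1/n] of the spectral distribution. *)
apply: (integral_eq_off_null _ mN N0) => w /rN rX.
have uG : X w *m (X w)^T \in unitmx by rewrite gram_unitmx rX.
have uZ : n%:R^-1 *: (X w *m (X w)^T) \in unitmx.
  by rewrite unitmxZ// unitfE invr_eq0.
rewrite integral_esd; last exact: measurable_invr.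
rewrite sum_inv_eigenvalues//; last by rewrite linearZ/= trmx_mul trmxK.
by rewrite /gram_inv rpinvT_mul// invmxZ// mxtraceZ invrK mulrA mulVf// mul1r.
Qed.
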